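(* If $G$ and $H$ are graphs having no isolated vertices, then $\iota(G\,\Box\, H)\le \beta(G)\beta(H)$. Moreover, the bound is sharp (there exist such graphs attaining equality).
   Context: All graphs are finite and simple; $\Box$ is the Cartesian product; $\beta$ is the vertex cover number. A set $A$ of vertices is isolating if no two vertices outside the closed neighborhood $N[A]$ are adjacent; $\iota$ is the minimum size of an isolating set. *)

(* Defs.v *)
From mathcomp Require Import all_boot.

Set Implicit Arguments.
Unset Strict Implicit.
Unset Printing Implicit Defensive.

Record sgraph := SGraph {
  vertex :> finType;
  adj : rel vertex;
  adj_sym : symmetric adj;
  adj_irrefl : irreflexive adj
}.

Arguments adj {s}.

Definition no_isolated_vertex (G : sgraph) : Prop :=
  forall x : G, exists y : G, adj x y.

Section CartesianProduct.
Variables G H : sgraph.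

Definition cart_adj : rel (G * H) := fun p q =>
  ((p.1 == q.1) && adj p.2 q.2) || (adj p.1 q.1 && (p.2 == q.2)).

Lemma cart_adj_sym : symmetric cart_adj.
Proof.
by move=> p q; rewrite /cart_adj !(eq_sym q.1, eq_sym q.2) !(adj_sym q.1, adj_sym q.2).
Qed.

Lemma cart_adj_irrefl : irreflexive cart_adj.
Proof. by move=> p; rewrite /cart_adj !adj_irrefl andbF. Qed.

Definition cart_prod : sgraph := SGraph cart_adj_sym cart_adj_irrefl.

End CartesianProduct.

Section Invariants.
Variable G : sgraph.
Implicit Types A C : {set G}.

Definition vertex_cover C : bool :=
  [forall x : G, forall y : G, adj x y ==> (x \in C) || (y \in C)].

Definition closed_nbh A : {set G} :=
  A :|: [set x | [exists y in A, adj y x]].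

Definition isolating A : bool :=
  [forall x : G, forall y : G,
    (x \notin closed_nbh A) && (y \notin closed_nbh A) ==> ~~ adj x y].

(* The next two lemmas make the default value [set: G] legitimate in the
   [arg min_ ...] below, so that these are the actual minima. *)
Lemma vertex_coverT : vertex_cover [set: G].
Proof. by apply/forallP=> x; apply/forallP=> y; rewrite !inE implybT. Qed.

Lemma isolatingT : isolating [set: G].
Proof. by apply/forallP=> x; apply/forallP=> y; rewrite !inE. Qed.

Definition vertex_cover_number : nat :=
  #|[arg min_(C < [set: G] | vertex_cover C) #|C|]|.

Definition isolation_number : nat :=
  #|[arg min_(A < [set: G] | isolating A) #|A|]|.

End Invariants.

(* Main.v *)
(** If [C] and [D] are vertex covers, then [C × D] isolates the product: a
    vertex with at least one coordinate in its cover is dominated, since a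
    coordinate outside its cover has a neighbor, necessarily in the cover.  The
    remaining vertices have both coordinates in the independent complements,
    hence are pairwise nonadjacent.  Sharpness: [K2 □ K2] is a 4-cycle. *)

Require Import Defs.
From mathcomp Require Import all_boot.

Set Implicit Arguments.
Unset Strict Implicit.
Unset Printing Implicit Defensive.

Section Invariants.
Variable G : sgraph.
Implicit Types A C : {set G}.

(** The disjunction becomes an implication so that, for a vertex outside the cover, any neighbor
    supplied by [no_isolated_vertex] is put into the cover. *)
Lemma vertex_coverP C :
  reflect (forall x y, adj x y -> x \notin C -> y \in C) (vertex_cover C).
Proof.
apply: (iffP forallP) => [cov x y xy xC | cov x].
  by have /forallP/(_ y) := cov x; rewrite xy (negPf xC).
apply/forallP=> y; apply/implyP=> xy.
by case: (boolP (x \in C)) => //= /(cov _ _ xy).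
Qed.

Lemma mem_closed_nbh A a x : a \in A -> adj a x -> x \in closed_nbh A.
Proof.
by move=> aA ax; rewrite !inE; apply/orP; right; apply/exists_inP; exists a.
Qed.

Lemma vertex_cover_number_le C : vertex_cover C -> vertex_cover_number G <= #|C|.
Proof.
by rewrite /vertex_cover_number => cov; case: arg_minnP => [|D _]; [exact: vertex_coverT | apply].
Qed.

Lemma vertex_cover_number_witness :
  exists2 C : {set G}, vertex_cover C & #|C| = vertex_cover_number G.
Proof.
rewrite /vertex_cover_number; case: arg_minnP => [|C cov _]; first exact: vertex_coverT.
by exists C.
Qed.

Lemma isolation_number_le A : isolating A -> isolation_number G <= #|A|.
Proof.
by rewrite /isolation_number => iso; case: arg_minnP => [|B _]; [exact: isolatingT | apply].
Qed.

(** The empty set dominates nothing, so the edge [x y] survives and no minimum isolating set is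
    empty. This gives the lower bound in the sharpness example. *)
Lemma isolation_number_gt0 (x y : G) : adj x y -> 0 < isolation_number G.
Proof.
move=> xy; rewrite /isolation_number; case: arg_minnP => [|A iso _]; first exact: isolatingT.
rewrite card_gt0; apply/eqP=> A0; move: iso; rewrite A0 => /forallP/(_ x)/forallP/(_ y).
have nbh0 z : z \in closed_nbh (set0 : {set G}) = false.
  by rewrite !inE; apply/exists_inP=> -[a]; rewrite inE.
by rewrite !nbh0 xy.
Qed.

End Invariants.

Section Product.
Variables G H : sgraph.
Hypotheses (nisoG : no_isolated_vertex G) (nisoH : no_isolated_vertex H).

Lemma isolating_setX (C : {set G}) (D : {set H}) :
  vertex_cover C -> vertex_cover D ->
  isolating (setX C D : {set cart_prod G H}).
Proof.
move=> /vertex_coverP covC /vertex_coverP covD.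
have undominated (p : cart_prod G H) :
    p \notin closed_nbh (setX C D : {set cart_prod G H}) ->
    p.1 \notin C /\ p.2 \notin D.
  case: p => x y /= und.
  (* When both coordinates avoid their covers the claim is immediate; in each of the other three
     cases [(x, y)] is dominated, against [und]. *)
  case: (boolP (x \in C)) => xC; case: (boolP (y \in D)) => yD //; case/negP: und.
  - by apply/setUP; left; rewrite in_setX xC.
  - have [y' yy'] := nisoH y.
    apply: (@mem_closed_nbh (cart_prod G H) _ (x, y')).
      by rewrite in_setX xC (covD _ _ yy').
    by rewrite /= /cart_adj /= eqxx adj_sym yy'.
  - have [x' xx'] := nisoG x.
    apply: (@mem_closed_nbh (cart_prod G H) _ (x', y)).
      by rewrite in_setX yD (covC _ _ xx').
    by rewrite /= /cart_adj /= eqxx adj_sym xx' orbT.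
apply/forallP=> p; apply/forallP=> q; apply/implyP=> /andP[].
move=> /undominated[pC pD] /undominated[qC qD].
(* An edge of the product projects to an edge of one factor, whose two ends would both be
   uncovered. *)
apply/negP=> /orP[/andP[_ pq] | /andP[pq _]].
  by rewrite (covD _ _ pq) in qD.
by rewrite (covC _ _ pq) in qC.
Qed.

Lemma isolation_number_cart_prod :
  isolation_number (cart_prod G H) <= vertex_cover_number G * vertex_cover_number H.
Proof.
have [C covC <-] := vertex_cover_number_witness G.
have [D covD <-] := vertex_cover_number_witness H.
by rewrite -cardsX; apply/isolation_number_le/isolating_setX.
Qed.

End Product.

Definition K2_adj : rel bool := fun x y => x != y.

Lemma K2_adj_sym : symmetric K2_adj.
Proof. by move=> x y; rewrite /K2_adj eq_sym. Qed.

Lemma K2_adj_irrefl : irreflexive K2_adj.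
Proof. by move=> x; rewrite /K2_adj eqxx. Qed.

Definition K2 : sgraph := SGraph K2_adj_sym K2_adj_irrefl.

Lemma K2_no_isolated_vertex : no_isolated_vertex K2.
Proof. by move=> x; exists (~~ x); case: x. Qed.

Lemma vertex_cover_number_K2 : vertex_cover_number K2 <= 1.
Proof.
rewrite -(cards1 (true : K2)); apply/vertex_cover_number_le/vertex_coverP.
by move=> [] []; rewrite !inE.
Qed.

(** Requiring nonempty graphs in the second part rules out the trivial equality [0 = 0] given by
    empty graphs. *)
Theorem theorem3p5 :
  (forall G H : sgraph, no_isolated_vertex G -> no_isolated_vertex H ->
     isolation_number (cart_prod G H)
       <= vertex_cover_number G * vertex_cover_number H)
  /\
  (exists G H : sgraph,
     [/\ 0 < #|G|, 0 < #|H|, no_isolated_vertex G, no_isolated_vertex H &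
       isolation_number (cart_prod G H)
         = vertex_cover_number G * vertex_cover_number H]).
Proof.
split; first exact: isolation_number_cart_prod.
have nisoK2 := K2_no_isolated_vertex.
exists K2, K2; split=> //; try by rewrite card_bool.
apply/eqP; rewrite eqn_leq isolation_number_cart_prod //=.
(* The product of cover numbers is at most [1 * 1], and one edge of the 4-cycle makes the isolation
   number at least 1. *)
apply: (leq_trans (leq_mul vertex_cover_number_K2 vertex_cover_number_K2)).
exact: (@isolation_number_gt0 (cart_prod K2 K2) (true, true) (true, false)).
Qed.
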